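(* Let $G_1$ be a finite nilpotent group none of whose Sylow subgroups is cyclic or generalized quaternion, with identity $e$. Let $n$ be a positive integer, let $Q_{2^k}$ be a generalized quaternion group of order $2^k$ with identity $e''$, and let $y$ be the unique element of order $2$ of $Q_{2^k}$. Then: (1) if $G=G_1$, then $\mathrm{Dom}(\mathcal{G}_E(G))=\{e\}$; (2) if $G=G_1\times\mathbb{Z}_n$ and $\gcd(|G_1|,n)=1$, then $\mathrm{Dom}(\mathcal{G}_E(G))=\{(e,x):x\in\mathbb{Z}_n\}$; (3) if $G=G_1\times Q_{2^k}$ and $\gcd(|G_1|,2)=1$, then $\mathrm{Dom}(\mathcal{G}_E(G))=\{(e,e''),(e,y)\}$; (4) if $G=G_1\times\mathbb{Z}_n\times Q_{2^k}$ and $\gcd(|G_1|,n)=\gcd(|G_1|,2)=\gcd(n,2)=1$, then $\mathrm{Dom}(\mathcal{G}_E(G))=\{(e,x,e''):x\in\mathbb{Z}_n\}\cup\{(e,x,y):x\in\mathbb{Z}_n\}$.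
   Context: For a group $G$, the enhanced power graph $\mathcal{G}_E(G)$ is the simple graph with vertex set $G$ in which two distinct elements $x,y$ are adjacent if and only if there is $w\in G$ with $x,y\in\langle w\rangle$. A dominating vertex of a graph $\Gamma$ is a vertex adjacent to every other vertex; $\mathrm{Dom}(\Gamma)$ is the set of all dominating vertices of $\Gamma$. $\mathbb{Z}_n$ is the cyclic group of order $n$. ''Sylow subgroups'' means Sylow $p$-subgroups for the primes $p$ dividing the order of the group. Every finite nilpotent group is isomorphic to a group of one of the four listed forms. *)

(* Defs.v *)
From mathcomp Require Import all_boot all_fingroup zmodp all_solvable.

Set Implicit Arguments.
Unset Strict Implicit.
Unset Printing Implicit Defensive.

Local Open Scope group_scope.

Record sgraph (T : finType) := SGraph {
  vertices : {set T};
  adj : rel T;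
  adj_vertices : forall x y, adj x y -> (x \in vertices) && (y \in vertices);
  adj_sym : symmetric adj;
  adj_irrefl : irreflexive adj
}.

Definition Dom (T : finType) (Gamma : sgraph T) : {set T} :=
  [set x in vertices Gamma
     | [forall y in vertices Gamma, (y != x) ==> adj Gamma x y]].

Definition epg_adj (gT : finGroupType) (G : {group gT}) : rel gT :=
  fun x y => [&& x \in G, y \in G, x != y
               & [exists w in G, (x \in <[w]>) && (y \in <[w]>)]].

Lemma epg_adj_vertices (gT : finGroupType) (G : {group gT}) x y :
  epg_adj G x y -> (x \in G) && (y \in G).
Proof. by case/and4P=> -> ->. Qed.

Lemma epg_adj_sym (gT : finGroupType) (G : {group gT}) :
  symmetric (epg_adj G).
Proof.
move=> x y; rewrite /epg_adj andbCA eq_sym; do 3!congr (_ && _).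
by apply: eq_existsb => w; rewrite (andbC (x \in _)).
Qed.

Lemma epg_adj_irrefl (gT : finGroupType) (G : {group gT}) :
  irreflexive (epg_adj G).
Proof. by move=> x; rewrite /epg_adj eqxx !andbF. Qed.

Definition enhanced_power_graph (gT : finGroupType) (G : {group gT}) :
    sgraph gT :=
  SGraph (@epg_adj_vertices gT G) (@epg_adj_sym gT G) (@epg_adj_irrefl gT G).

Definition generalized_quaternion (k : nat)
    (gT : finGroupType) (G : {group gT}) : Prop :=
  (2 < k)%N /\ G \isog 'Q_(2 ^ k)%N.

Definition no_cyclic_or_quaternion_Sylow
    (gT : finGroupType) (G : {group gT}) : Prop :=
  forall (p : nat) (P : {group gT}),
    prime p -> p %| #|G| -> p.-Sylow(G) P ->
    ~ (cyclic P \/ exists k : nat, generalized_quaternion k P).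

Definition dirprod (gT hT : finGroupType) (G : {group gT}) (H : {group hT}) :
    {group gT * hT} := [group of setX G H].

(* Main.v *)
Require Import Defs.
From mathcomp Require Import all_boot all_fingroup zmodp all_solvable.

(** Say that [x] and [y] are cyclically related in [G] when some cyclic subgroup
    of [G] contains both; a dominating vertex is an element of [G] cyclically
    related to all of [G] ([Dom_epgP]).  Four facts determine these elements.

    - A Sylow obstruction.  Dominating vertices are stable under powers, so if a
      prime [p] divides the order of one of them, then a dominating vertex [z] of
      order [p] exists.  A cyclic group has at most one subgroup of order [p], so
      [<[z]>] contains every element of order [p] of [G].  A Sylow [p]-subgroup
      containing [z] thus has a single subgroup of order [p], and the [p]-groups
      with this property are the cyclic and the generalized quaternion ones
      ([Dom_epg_Sylow]).  Hence [G1] has only the trivial dominating vertex.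
    - In a cyclic group every element is dominating ([Dom_epg_cyclic]).
    - A dominating vertex is central, and the centre of a generalized quaternion
      group is generated by its unique involution; conversely, the involution is
      a power of every nontrivial element ([Dom_epg_quaternion]).
    - For factors of coprime orders, [<[(u, v)]>] is the whole product of [<[u]>]
      and [<[v]>] by the Chinese remainder theorem, so the dominating vertices of
      a product are the pairs of dominating vertices ([Dom_epg_dirprod]).

    The four claims follow by computing the factors separately. *)

Set Implicit Arguments.
Unset Strict Implicit.

Local Open Scope group_scope.

(** * Dominating vertices of the enhanced power graph *)

(** The graph has no loops, but the case [y = x] can be included for free, with
    the witness [w = x]; domination is then stated without a disequality. *)
Lemma Dom_epgP (gT : finGroupType) (G : {group gT}) x :
  reflect (x \in G /\ forall y, y \in G ->
             exists w, [/\ w \in G, x \in <[w]> & y \in <[w]>])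
          (x \in Dom (enhanced_power_graph G)).
Proof.
rewrite inE /=; apply: (iffP andP) => -[Gx domx]; split=> //.
  move=> y Gy; have [-> | yDx] := eqVneq y x.
    by exists x; rewrite Gx !cycle_id.
  move/forall_inP/(_ y Gy)/implyP/(_ yDx): domx.
  by case/and4P=> _ _ _ /exists_inP[w Gw /andP[wx wy]]; exists w.
apply/forall_inP=> y Gy; apply/implyP=> yDx; have [w [Gw wx wy]] := domx y Gy.
rewrite /epg_adj Gx Gy eq_sym yDx; apply/exists_inP; exists w => //.
by rewrite wx.
Qed.

Lemma Dom_epg1 (gT : finGroupType) (G : {group gT}) :
  1 \in Dom (enhanced_power_graph G).
Proof.
apply/Dom_epgP; split=> // y Gy; exists y.
by rewrite Gy group1 cycle_id.
Qed.

Lemma Dom_epgX (gT : finGroupType) (G : {group gT}) x m :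
  x \in Dom (enhanced_power_graph G) ->
  x ^+ m \in Dom (enhanced_power_graph G).
Proof.
case/Dom_epgP=> Gx domx; apply/Dom_epgP; split=> [|y /domx[w [Gw wx wy]]].
  exact: groupX.
by exists w; rewrite groupX.
Qed.

Lemma Dom_epg_center (gT : finGroupType) (G : {group gT}) :
  Dom (enhanced_power_graph G) \subset 'Z(G).
Proof.
apply/subsetP=> x /Dom_epgP[Gx domx]; apply/centerP; split=> // y /domx[w [_ wx wy]].
exact: (centsP (cycle_abelian w) x wx y wy).
Qed.

Lemma Dom_epg_cyclic (gT : finGroupType) (G : {group gT}) :
  cyclic G -> Dom (enhanced_power_graph G) = G.
Proof.
case/cyclicP=> g defG; apply/setP=> x; apply/Dom_epgP/idP => [[] // | Gx].
by split=> // y Gy; exists g; rewrite -defG Gx Gy defG cycle_id.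
Qed.

(** * The Sylow obstruction *)

(** A cyclic group containing both elements has only one subgroup of order [p]. *)
Lemma Dom_epg_same_order (gT : finGroupType) (G : {group gT}) z y :
  z \in Dom (enhanced_power_graph G) -> y \in G -> #[y] = #[z] -> y \in <[z]>.
Proof.
case/Dom_epgP=> _ domz /domz[w [_ wz wy]] oy.
have /eqP <- : <[y]> == <[z]> :> {set gT}; last exact: cycle_id.
rewrite (eq_subG_cyclic (cycle_cyclic w)) ?cycle_subG //.
by rewrite -!orderE oy.
Qed.

(** The power [z] of [x] of order [p] is again dominating, so in a Sylow subgroup
    [P] containing it all elements of order [p] lie in [<[z]>]: thus ['Ohm_1(P)]
    has order [p], which characterizes cyclic and generalized quaternion groups
    among the nontrivial [p]-groups. *)
Lemma Dom_epg_Sylow (gT : finGroupType) (G : {group gT}) x p :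
    x \in Dom (enhanced_power_graph G) -> prime p -> p %| #[x] ->
  exists2 P : {group gT}, p.-Sylow(G) P
    & cyclic P \/ exists k, generalized_quaternion k P.
Proof.
move=> domx p_pr p_x; pose z := x ^+ (#[x] %/ p).
have oz: #[z] = p.
  by rewrite orderXdiv ?dvdn_div // divnA // mulKn.
have domz: z \in Dom (enhanced_power_graph G) by apply: Dom_epgX.
have Gz: z \in G by case/Dom_epgP: domz.
have szG: <[z]> \subset G by rewrite cycle_subG.
have p_z: p.-group <[z]> by rewrite /pgroup -orderE oz pnat_id.
have [P sylP szP] := Sylow_superset szG p_z.
exists P => //; have [sPG pP] := (pHall_sub sylP, pHall_pgroup sylP).
have ntP: P :!=: 1.
  apply: contraTneq szP => ->.
  by rewrite subG1 cycle_eq1 -order_gt1 oz prime_gt1.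
have defP1: 'Ohm_1(P) = <[z]>.
  apply/eqP; rewrite eqEsubset (OhmE 1 pP) expn1; apply/andP; split.
    rewrite gen_subG; apply/subsetP=> y /LdivP[Py yp].
    have [-> // | nty] := eqVneq y 1.
    by rewrite (Dom_epg_same_order domz) ?(subsetP sPG) ?oz ?(nt_prime_order p_pr).
  rewrite cycle_subG mem_gen //; apply/LdivP; rewrite -[p]oz expg_order.
  by split=> //; rewrite -cycle_subG.
have /(prime_Ohm1P pP ntP)/orP[|]: #|'Ohm_1(P)| = p by rewrite defP1 -orderE.
  by left.
case/andP=> _ /eqP/quaternion_classP[k k_gt2 isoP].
by right; exists k.
Qed.

Lemma Dom_epg_no_cyclic_or_quaternion_Sylow (gT : finGroupType)
    (G : {group gT}) :
  no_cyclic_or_quaternion_Sylow G -> Dom (enhanced_power_graph G) = [set 1].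
Proof.
move=> sylG; apply/eqP; rewrite eqEsubset sub1set Dom_epg1 andbT.
apply/subsetP=> x domx; apply: contraT; rewrite inE -order_gt1 => x_gt1.
have p_pr := pdiv_prime x_gt1; have p_x := pdiv_dvd #[x].
have [P sylP] := Dom_epg_Sylow domx p_pr p_x.
have Gx: x \in G by case/Dom_epgP: domx.
by case/(sylG _ _ p_pr (dvdn_trans p_x (order_dvdG Gx)) sylP).
Qed.

(** * Generalized quaternion groups *)

(** The upper bound is the centre, of order 2.  The lower bound holds because
    every nontrivial cyclic subgroup has even order, hence contains the unique
    involution [y]: the witness for the pair [y], [t] is [t] itself. *)
Lemma Dom_epg_quaternion k (qT : finGroupType) (Q : {group qT}) y :
    generalized_quaternion k Q -> y \in Q -> #[y] = 2 ->
  Dom (enhanced_power_graph Q) = [set 1; y].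
Proof.
case=> k_gt2 isoQ Qy oy.
have [[u v] genQ _] := generators_quaternion k_gt2 isoQ.
have [_ _ [defZ _ involQ _ _] _ _] := quaternion_structure k_gt2 genQ isoQ.
have invol_y t : t \in Q -> #[t] = 2 -> t = y.
  by move=> Qt ot; rewrite (involQ y) // -(involQ t).
have defZy: 'Z(Q) = [set 1; y] by rewrite defZ -(involQ y) // cycle2g.
apply/eqP; rewrite eqEsubset -{1}defZy Dom_epg_center subUset !sub1set Dom_epg1.
apply/Dom_epgP; split=> // t Qt.
have [-> | ntt] := eqVneq t 1; first by exists y; rewrite Qy cycle_id group1.
exists t; rewrite Qt cycle_id; split=> //.
have t_even: 2 %| #|<[t]>|.
  have pQ: 2.-group Q by rewrite /pgroup (card_isog isoQ) card_quaternion ?pnatX.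
  have [|_ -> //] := pgroup_pdiv (mem_p_elt pQ Qt); first by rewrite cycle_eq1.
have [s ts os] := Cauchy (isT : prime 2) t_even.
by rewrite -(invol_y s) // (subsetP _ s ts) ?cycle_subG.
Qed.

(** * Products of groups of coprime orders *)

Lemma pairXg (gT hT : finGroupType) (u : gT) (v : hT) m :
  (u, v) ^+ m = (u ^+ m, v ^+ m).
Proof. by elim: m => // m IHm; rewrite !expgS IHm. Qed.

Lemma mem_cycle_pair (gT hT : finGroupType) (a u : gT) (b v : hT) :
  (a, b) \in <[(u, v)]> -> a \in <[u]> /\ b \in <[v]>.
Proof. by case/cycleP=> m; rewrite pairXg => -[-> ->]; rewrite !mem_cycle. Qed.

Lemma mem_cycle_pair_coprime (gT hT : finGroupType) (a u : gT) (b v : hT) :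
    coprime #[u] #[v] -> a \in <[u]> -> b \in <[v]> ->
  (a, b) \in <[(u, v)]>.
Proof.
move=> co_uv /cycleP[i ->] /cycleP[j ->].
apply/cycleP; exists (chinese #[u] #[v] i j); rewrite pairXg.
by congr (_, _); apply/eqP; rewrite eq_expg_mod_order
  ?(chinese_modl co_uv) ?(chinese_modr co_uv).
Qed.

(** A witness for a pair in the product projects to a witness in each factor;
    conversely, witnesses [u] and [v] in the factors combine into [(u, v)] because
    their orders are coprime. *)
Lemma Dom_epg_dirprod (gT hT : finGroupType) (G : {group gT}) (H : {group hT}) :
    coprime #|G| #|H| ->
  Dom (enhanced_power_graph (dirprod G H))
    = setX (Dom (enhanced_power_graph G)) (Dom (enhanced_power_graph H)).
Proof.
move=> co_GH; apply/setP=> -[a b]; rewrite in_setX.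
apply/Dom_epgP/andP=> [[] | [/Dom_epgP[Ga doma] /Dom_epgP[Hb domb]]].
  rewrite in_setX => /andP[Ga Hb] domab.
  split; apply/Dom_epgP; split=> // c Gc.
    have [|[u v]] := domab (c, 1); first by rewrite in_setX Gc group1.
    rewrite in_setX => -[/andP[Gu _] /mem_cycle_pair[ua _]].
    by case/mem_cycle_pair=> uc _; exists u.
  have [|[u v]] := domab (1, c); first by rewrite in_setX Gc group1.
  rewrite in_setX => -[/andP[_ Hv] /mem_cycle_pair[_ vb]].
  by case/mem_cycle_pair=> _ vc; exists v.
split=> [|[c d]]; first by rewrite in_setX Ga.
rewrite in_setX => /andP[/doma[u [Gu ua uc]] /domb[v [Hv vb vd]]].
have co_uv: coprime #[u] #[v].
  by rewrite (coprime_dvdl (order_dvdG Gu)) ?(coprime_dvdr (order_dvdG Hv)).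
by exists (u, v); rewrite in_setX Gu Hv !mem_cycle_pair_coprime.
Qed.

(** * The four families of nilpotent groups *)

Lemma Zp_group_cyclic n : cyclic (Zp n).
Proof.
rewrite /Zp; case: ifP => _; last exact: cyclic1.
by rewrite Zp_cycle cycle_cyclic.
Qed.

(* Zp n is the cyclic group of order n for every n > 0: it is all of 'Z_n     *)
(* when n > 1, and the trivial subgroup of 'Z_1 (= 'I_2) when n = 1.          *)
Theorem theorem4p1 (gT : finGroupType) (G1 : {group gT})
    (nilG1 : nilpotent G1) (sylG1 : no_cyclic_or_quaternion_Sylow G1)
    (n : nat) (n_gt0 : 0 < n)
    (k : nat) (qT : finGroupType) (Q : {group qT})
    (quatQ : generalized_quaternion k Q)
    (y : qT) (Qy : y \in Q) (oy : #[y] = 2) :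
  [/\ Dom (enhanced_power_graph G1) = [set 1],
      gcdn #|G1| n = 1%N ->
      Dom (enhanced_power_graph (dirprod G1 (Zp_group n)))
        = [set (1, x) | x in Zp n],
      gcdn #|G1| 2 = 1%N ->
      Dom (enhanced_power_graph (dirprod G1 Q)) = [set (1, 1); (1, y)]
    & [/\ gcdn #|G1| n = 1%N, gcdn #|G1| 2 = 1%N & gcdn n 2 = 1%N] ->
      Dom (enhanced_power_graph (dirprod (dirprod G1 (Zp_group n)) Q))
        = [set (1, x, 1) | x in Zp n] :|: [set (1, x, y) | x in Zp n]].
Proof.
have domG1 := Dom_epg_no_cyclic_or_quaternion_Sylow sylG1.
have domZ : Dom (enhanced_power_graph (Zp_group n)) = Zp n.
  exact/Dom_epg_cyclic/Zp_group_cyclic.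
have domQ := Dom_epg_quaternion quatQ Qy oy.
have co_Q m : gcdn m 2 = 1%N -> coprime m #|Q|.
  case: quatQ => k_gt2 isoQ /eqP co_m2.
  by rewrite (card_isog isoQ) card_quaternion // coprimeXr.
have co_Z : gcdn #|G1| n = 1%N -> coprime #|G1| #|Zp_group n|.
  by move/eqP; rewrite /= card_Zp.
split=> // [/co_Z co_G1Z | /co_Q co_G1Q | [co_G1n co_G12 co_n2]].
- rewrite Dom_epg_dirprod // domG1 domZ; apply/setP=> -[a x]; rewrite in_setX inE.
  by apply/andP/imsetP=> [[/eqP-> Zx] | [x' Zx [-> ->]]]; [exists x | rewrite eqxx].
- rewrite Dom_epg_dirprod // domG1 domQ; apply/setP=> -[a b].
  by rewrite !inE !xpair_eqE -andb_orr.
rewrite Dom_epg_dirprod; last first.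
  by rewrite cardsX coprimeMl /= card_Zp // !co_Q.
rewrite Dom_epg_dirprod ?co_Z // domG1 domZ domQ; apply/setP=> -[[a x] b].
rewrite !in_setX !inE; apply/andP/orP=> [[/andP[/eqP-> Zx] /orP[]/eqP->] | ].
- by left; apply: imset_f.
- by right; apply: imset_f.
by case=> /imsetP[x' Zx [-> -> ->]]; rewrite Zx !eqxx ?orbT.
Qed.
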